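(* Let $M$ be a Riemannian manifold of dimension $m\ge2$, $\Omega\subset M$ a domain, $\epsilon>0$, $p>1$, and let $u_\epsilon$ be a solution on $\Omega$ of $$\mathrm{div}\left(\left(|\nabla u_\epsilon|^2+\epsilon\right)^{\frac{p-2}{2}}\nabla u_\epsilon\right)=0.$$ Then the Hessian $\nabla du_\epsilon$ of $u_\epsilon$ satisfies $$|du_\epsilon|^2\,|\nabla du_\epsilon|^2\ \ge\ \frac{1+\kappa_1}{4}\left|\nabla|du_\epsilon|^2\right|^2$$ at every $x\in\Omega$, where $$\kappa_1=\begin{cases}\frac{1}{m-1}&\text{if }p\ge2,\\[3pt]\frac{(p-1)^2}{m-1}&\text{if }1<p<2.\end{cases}$$
   Context: Solutions $u_\epsilon$ are $C^\infty$ on $\Omega$ (the equation is nondegenerate). $|\nabla du_\epsilon|$ is the Hilbert–Schmidt norm of the Hessian. *)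

(* Defs.v *)
From mathcomp Require Import all_boot all_order all_algebra.
From mathcomp Require Import all_classical all_reals all_analysis.
Set Implicit Arguments.
Unset Strict Implicit.
Unset Printing Implicit Defensive.
Import Order.TTheory GRing.Theory Num.Theory.
Import numFieldNormedType.Exports.
Local Open Scope classical_set_scope.
Local Open Scope ring_scope.

(* Tensor fields on a manifold are represented by their components in the
   charts of an atlas: (co)vectors are row vectors, (0,2)-tensors are square
   matrices.  The pointwise quantities below (norms, gradient, divergence,
   Hessian) are the usual coordinate expressions of invariantly defined objects,
   so their scalar values do not depend on the chart in which they are computed. *)

Section Coordinates.
Context {R : realType} {m : nat}.
Implicit Types (U : set 'rV[R]_m) (f : 'rV[R]_m -> R) (y : 'rV[R]_m).
Implicit Types (g : 'rV[R]_m -> 'M[R]_m) (X w : 'rV[R]_m -> 'rV[R]_m).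

Definition partial (k : 'I_m) f y : R := 'D_(delta_mx 0 k) f y.

(* Class C^n; only meant for open U. *)
Fixpoint Cn_on (n : nat) U f : Prop :=
  (forall y, U y -> {for y, continuous f}) /\
  match n with
  | 0%N => True
  | n'.+1 => forall k : 'I_m,
      (forall y, U y -> derivable f y (delta_mx 0 k)) /\ Cn_on n' U (partial k f)
  end.

Definition smooth_on U f : Prop := forall n, Cn_on n U f.

(* Row c, column d: the derivative of the d-th component in the c-th direction,
   i.e. the transpose of the usual Jacobian matrix. *)
Definition jacobian_tr (F : 'rV[R]_m -> 'rV[R]_m) y : 'M[R]_m :=
  \matrix_(c, d) partial c (fun z => F z 0 d) y.

(* |v|^2 = g_ab v^a v^b *)
Definition vec_sqnorm (G : 'M[R]_m) (v : 'rV[R]_m) : R :=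
  \sum_a \sum_b G a b * v 0 a * v 0 b.

(* |w|^2 = g^ab w_a w_b *)
Definition covec_sqnorm (G : 'M[R]_m) (w : 'rV[R]_m) : R :=
  \sum_a \sum_b invmx G a b * w 0 a * w 0 b.

(* Hilbert-Schmidt norm: |T|^2 = g^ac g^bd T_ab T_cd *)
Definition tensor_sqnorm (G T : 'M[R]_m) : R :=
  \sum_a \sum_b \sum_c \sum_d
    invmx G a c * invmx G b d * T a b * T c d.

(* Levi-Civita connection:
   Gamma^k_ab = 1/2 g^kl (d_a g_bl + d_b g_al - d_l g_ab) *)
Definition christoffel g (k a b : 'I_m) y : R :=
  2^-1 * \sum_l invmx (g y) k l *
    (partial a (fun z => g z b l) y + partial b (fun z => g z a l) y
     - partial l (fun z => g z a b) y).

Definition differential f y : 'rV[R]_m := \row_a partial a f y.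

(* (grad f)^a = g^ab d_b f *)
Definition gradient g f y : 'rV[R]_m :=
  \row_a \sum_b invmx (g y) a b * differential f y 0 b.

(* (nabla_a X)^b = d_a X^b + Gamma^b_ac X^c *)
Definition nabla_vec g X y : 'M[R]_m :=
  \matrix_(a, b) (partial a (fun z => X z 0 b) y
                  + \sum_c christoffel g b a c y * X y 0 c).

(* (nabla_a w)_b = d_a w_b - Gamma^c_ab w_c *)
Definition nabla_covec g w y : 'M[R]_m :=
  \matrix_(a, b) (partial a (fun z => w z 0 b) y
                  - \sum_c christoffel g c a b y * w y 0 c).

Definition divergence g X y : R := \tr (nabla_vec g X y).

Definition hessian g f y : 'M[R]_m := nabla_covec g (differential f) y.

End Coordinates.

(* chart_inv i is only meaningful on the image of the chart i. *)
Record smooth_manifold (R : realType) (m : nat) := SmoothManifold {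
  carrier :> topologicalType;
  carrier_hausdorff : hausdorff_space carrier;
  carrier_second_countable : @second_countable carrier;
  chart : Type;
  chart_dom : chart -> set carrier;
  chart_map : chart -> carrier -> 'rV[R]_m;
  chart_inv : chart -> 'rV[R]_m -> carrier;
  chart_dom_open : forall i, open (chart_dom i);
  chart_cover : forall x, exists i, chart_dom i x;
  chart_img_open : forall i, open (chart_map i @` chart_dom i);
  chart_mapK : forall i x, chart_dom i x -> chart_inv i (chart_map i x) = x;
  chart_map_continuous : forall i x,
    chart_dom i x -> {for x, continuous (chart_map i)};
  chart_inv_continuous : forall i y,
    (chart_map i @` chart_dom i) y -> {for y, continuous (chart_inv i)};
  chart_transition_smooth : forall i j (k : 'I_m),
    smooth_on (chart_map i @` (chart_dom i `&` chart_dom j))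
      (fun y => chart_map j (chart_inv i y) 0 k)
}.

Arguments chart {R m} _.
Arguments chart_dom {R m _} _ _.
Arguments chart_map {R m _} _ _.
Arguments chart_inv {R m _} _ _.

Definition transition (R : realType) (m : nat) (M : smooth_manifold R m)
    (i j : chart M) (y : 'rV[R]_m) : 'rV[R]_m := chart_map j (chart_inv i y).

Record riemannian_metric (R : realType) (m : nat) (M : smooth_manifold R m) :=
  RiemannianMetric {
  metric :> chart M -> 'rV[R]_m -> 'M[R]_m;
  metric_smooth : forall i (a b : 'I_m),
    smooth_on (chart_map i @` chart_dom i) (fun y => metric i y a b);
  metric_sym : forall i y, (chart_map i @` chart_dom i) y ->
    (metric i y)^T = metric i y;
  metric_pos : forall i y, (chart_map i @` chart_dom i) y ->
    forall v : 'rV[R]_m, v != 0 -> 0 < vec_sqnorm (metric i y) v;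
  metric_compat : forall i j y,
    (chart_map i @` (chart_dom i `&` chart_dom j)) y ->
    metric i y = jacobian_tr (transition i j) y *m metric j (transition i j y)
                 *m (jacobian_tr (transition i j) y)^T
}.

Section OnManifold.
Context {R : realType} {m : nat} {M : smooth_manifold R m}.
Implicit Types (Omega : set M) (u : M -> R) (g : riemannian_metric M).

Definition domain Omega : Prop :=
  [/\ open Omega, connected Omega & Omega !=set0].

Definition in_chart u (i : chart M) : 'rV[R]_m -> R := u \o chart_inv i.

Definition smooth_fun_on Omega u : Prop := forall i : chart M,
  smooth_on (chart_map i @` (chart_dom i `&` Omega)) (in_chart u i).

(* The vector field (|grad u|^2 + eps)^((p-2)/2) grad u, in the chart i. *)
Definition p_eps_field g (p eps : R) u (i : chart M) (y : 'rV[R]_m) : 'rV[R]_m :=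
  let X := gradient (g i) (in_chart u i) y in
  (vec_sqnorm (g i y) X + eps) `^ ((p - 2) / 2) *: X.

Definition p_eps_solution g (p eps : R) Omega u : Prop :=
  smooth_fun_on Omega u /\
  forall x, Omega x -> forall i, chart_dom i x ->
    divergence (g i) (p_eps_field g p eps u i) (chart_map i x) = 0.

(* |du|^2, |nabla du|^2 and |nabla |du|^2|^2 at x, computed in the chart i. *)
Definition sqnorm_du g u (i : chart M) (x : M) : R :=
  covec_sqnorm (g i (chart_map i x))
    (differential (in_chart u i) (chart_map i x)).

Definition sqnorm_hess g u (i : chart M) (x : M) : R :=
  tensor_sqnorm (g i (chart_map i x))
    (hessian (g i) (in_chart u i) (chart_map i x)).

Definition sqnorm_grad_sqnorm_du g u (i : chart M) (x : M) : R :=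
  vec_sqnorm (g i (chart_map i x))
    (gradient (g i)
       (fun y => covec_sqnorm (g i y) (differential (in_chart u i) y))
       (chart_map i x)).

End OnManifold.

Definition kappa1 (R : realType) (m : nat) (p : R) : R :=
  if 2 <= p then (m%:R - 1)^-1 else (p - 1) ^+ 2 / (m%:R - 1).

(* Main.v *)
(** At a point where [du] does not vanish, take an orthonormal frame whose first
    vector is [grad u / |grad u|], and let [T] be the Hessian.  Differentiating
    [|du|^2] with the Levi-Civita connection gives
    [nabla |du|^2 = 2 T(grad u, .)], and dividing the equation by
    [(|du|^2 + eps)^((p-2)/2)] turns it into
    [tr T = - (p - 2) theta T_11] with [theta = |du|^2 / (|du|^2 + eps)] in
    [[0, 1[], that is [sum_(i > 1) T_ii = - (1 + (p - 2) theta) T_11].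
    Hence, by Cauchy-Schwarz on the remaining diagonal entries,
    [|T|^2 >= T_11^2 + 2 sum_(j > 1) T_1j^2
              + (1 + (p - 2) theta)^2 T_11^2 / (m - 1)],
    which dominates [(1 + kappa_1) sum_j T_1j^2] because
    [kappa_1 (m - 1) <= (1 + (p - 2) theta)^2] and [kappa_1 <= 1].  The factor 2
    comes from the symmetry of [T]. *)

Require Import Defs.
From mathcomp Require Import all_boot all_order all_algebra.
From mathcomp Require Import all_classical all_reals all_analysis.
From mathcomp Require Import perm ring lra.
Set Implicit Arguments.
Unset Strict Implicit.
Unset Printing Implicit Defensive.
Import Order.TTheory GRing.Theory Num.Theory.
Import numFieldNormedType.Exports.
Local Open Scope classical_set_scope.
Local Open Scope ring_scope.

(** * Linear algebra *)

Definition posdef (R : realType) (n : nat) (A : 'M[R]_n) : Prop :=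
  forall v : 'rV[R]_n, v != 0 -> 0 < (v *m A *m v^T) 0 0.

(** Cholesky factorization by induction on the size: once the first row and column are eliminated,
    the Schur complement [D'] is again symmetric and positive definite. Applied to the inverse
    metric, the factor [L] plays the role of an orthonormal frame. *)
Lemma posdef_gram (R : realType) (n : nat) (A : 'M[R]_n) :
  A^T = A -> posdef A -> exists L : 'M[R]_n, A = L^T *m L.
Proof.
elim: n A => [|n IHn] A symA posA.
  by exists 0; apply/matrixP => -[].
pose a := A 0 0; pose B : 'M[R]_(1 + n) := A.
pose b := ursubmx B; pose D := drsubmx B.
have bT : dlsubmx B = b^T.
  by rewrite /b trmx_ursub; congr dlsubmx; rewrite /B symA.
have DT : D^T = D by rewrite /D trmx_drsub; congr drsubmx; rewrite /B symA.
have eB : B = block_mx a%:M b b^T D.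
  rewrite -bT /b /D -[LHS]submxK; congr block_mx.
  rewrite [LHS]mx11_scalar; congr (_%:M); rewrite !mxE /a /B.
  by congr (A _ _); apply/val_inj.
have quad (x : R) (v : 'rV[R]_n) : row_mx x%:M v *m B *m (row_mx x%:M v)^T =
    (a * x ^+ 2)%:M + x *: (b *m v^T) + x *: (v *m b^T) + v *m D *m v^T.
  rewrite eB mul_row_block tr_row_mx mul_row_col tr_scalar_mx !mulmxDl.
  rewrite -!scalar_mxM !mul_scalar_mx !mul_mx_scalar -!scalemxAl.
  rewrite !addrA; congr (_ + _); rewrite addrAC; congr (_%:M + _ + _); ring.
have a0 : 0 < a.
  have /posA : (row_mx 1%:M 0 : 'rV[R]_(1 + n)) != 0.
    apply/eqP => /(congr1 lsubmx); rewrite row_mxKl linear0 => /matrixP.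
    by move/(_ 0 0); rewrite !mxE => /eqP; rewrite oner_eq0.
  rewrite quad trmx0 !(mulmx0, mul0mx) !scaler0 !addr0.
  by rewrite mxE expr1n mulr1.
pose D' := D - a^-1 *: (b^T *m b).
have [L' eL'] : exists L' : 'M[R]_n, D' = L'^T *m L'.
  apply: IHn => [|v v0].
    by rewrite /D' linearB linearZ /= trmx_mul trmxK DT.
  (* This [x] minimizes the quadratic form of [B] over the vectors [(x, v)] with [v] fixed; the
     minimum is the value of the Schur complement at [v]. *)
  pose x := - a^-1 * (b *m v^T) 0 0.
  have /posA : (row_mx x%:M v : 'rV[R]_(1 + n)) != 0.
    apply: contra v0 => /eqP /(congr1 rsubmx).
    by rewrite row_mxKr linear0 => ->.
  rewrite quad /D' mulmxBr mulmxBl -scalemxAr -scalemxAl !mulmxA.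
  rewrite -[v *m b^T *m b *m v^T]mulmxA.
  have -> : v *m b^T = (b *m v^T)^T by rewrite trmx_mul trmxK.
  rewrite [b *m v^T]mx11_scalar tr_scalar_mx -scalar_mxM.
  set t := (b *m v^T) 0 0; move: (v *m D *m v^T) => Q.
  rewrite !mxE /= /x -/t !mulr1n.
  suff -> : a * (- a^-1 * t) ^+ 2 + - a^-1 * t * t + - a^-1 * t * t =
            - (a^-1 * (t * t)) by rewrite addrC.
  by field; rewrite gt_eqF.
pose L : 'M[R]_(1 + n) :=
  block_mx (Num.sqrt a)%:M ((Num.sqrt a)^-1 *: b) 0 L'.
exists L; suff : B = L^T *m L by [].
have sa0 : Num.sqrt a != 0 by rewrite gt_eqF // sqrtr_gt0.
have sa2 : Num.sqrt a * Num.sqrt a = a by rewrite -expr2 sqr_sqrtr // ltW.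
rewrite eB /L tr_block_mx mulmx_block tr_scalar_mx trmx0.
rewrite !mul0mx !addr0 -scalar_mxM sa2 mul_scalar_mx mulmx0 addr0.
rewrite scalerA mulfV // scale1r linearZ /= mul_mx_scalar scalerA mulfV //.
rewrite scale1r -eL' /D' -scalemxAl -scalemxAr scalerA -invfM sa2.
by rewrite addrC subrK.
Qed.

Lemma posdef_unitmx (R : realType) (n : nat) (A : 'M[R]_n) :
  posdef A -> A \in unitmx.
Proof.
move=> posA; rewrite -row_free_unit -kermx_eq0; apply/eqP/row_matrixP => i.
rewrite row0; apply/eqP/negPn/negP => /posA.
by rewrite -row_mul mulmx_ker row0 mul0mx mxE ltxx.
Qed.

Lemma posdef_invmx (R : realType) (n : nat) (A : 'M[R]_n) :
  A^T = A -> posdef A -> posdef (invmx A).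
Proof.
move=> symA posA v v0; have uA := posdef_unitmx posA.
have : v *m invmx A != 0.
  by apply: contra v0 => /eqP e; rewrite -(mulmxKV uA v) e mul0mx.
by move/posA; rewrite trmx_mul trmx_inv symA mulmxKV // mulmxA.
Qed.

Lemma mxtrace_gram_ge0 (R : realType) (m n : nat) (S : 'M[R]_(m, n)) :
  0 <= \tr (S *m S^T).
Proof.
apply: sumr_ge0 => i _; rewrite mxE; apply: sumr_ge0 => j _.
by rewrite mxE -expr2 sqr_ge0.
Qed.

Lemma mxtrace_outer (R : comNzRingType) (n : nat) (x y : 'rV[R]_n) :
  \tr (x^T *m y) = (y *m x^T) 0 0.
Proof. by rewrite mxtrace_mulC trace_mx11. Qed.

(** Cyclicity of the trace merges the cross terms in pairs, so no symmetry of [A], [B], [C] is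
    involved. The signs are those of the projection [S] in the next lemma. *)
Lemma mxtrace_sqr_comb (R : comNzRingType) (n : nat) (A B C : 'M[R]_n)
    (a b c d : R) (S := a *: A - b *: B + c *: C - d%:M) :
  \tr (S *m S) = a ^+ 2 * \tr (A *m A) + b ^+ 2 * \tr (B *m B)
    + c ^+ 2 * \tr (C *m C) + d ^+ 2 * n%:R
    - 2 * a * b * \tr (A *m B) + 2 * a * c * \tr (A *m C) - 2 * a * d * \tr A
    - 2 * b * c * \tr (B *m C) + 2 * b * d * \tr B - 2 * c * d * \tr C.
Proof.
have trl X : \tr (S *m X) = a * \tr (A *m X) - b * \tr (B *m X)
    + c * \tr (C *m X) - d * \tr X.
  rewrite /S mulmxBl mulmxDl mulmxBl -!scalemxAl mul_scalar_mx.
  by rewrite linearB linearD linearB !linearZ.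
have trr X : \tr (X *m S) = a * \tr (A *m X) - b * \tr (B *m X)
    + c * \tr (C *m X) - d * \tr X by rewrite mxtrace_mulC.
rewrite trl !trr /S.
rewrite !(mxtraceD, raddfN) /= !mxtraceZ mxtrace_scalar.
rewrite [\tr (B *m A)]mxtrace_mulC [\tr (C *m A)]mxtrace_mulC.
rewrite [\tr (C *m B)]mxtrace_mulC -mulr_natr; ring.
Qed.

(* The difference between the two sides is, up to a positive factor, the
   squared norm of the component of [T] orthogonal to the tensors
   [w (x) y + y (x) w], [y] arbitrary, and to the identity on the complement of [w]. *)
Lemma refined_trace_inequality (R : realType) (m : nat) (T : 'M[R]_m)
    (w : 'rV[R]_m) (v k a t mu : R) :
  T^T = T -> 0 < mu -> m%:R = 1 + mu -> 0 < v ->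
  v = (w *m w^T) 0 0 -> a = (w *m T *m w^T) 0 0 ->
  k = (w *m T *m T *m w^T) 0 0 -> t = \tr T ->
  mu * (2 * k * v - a ^+ 2) + (t * v - a) ^+ 2
    <= v ^+ 2 * mu * \tr (T *m T).
Proof.
move=> symT mu0 em v0 ev ea ek et.
have [z ez] : exists z, z = w *m T by exists (w *m T).
have ezT : T *m w^T = z^T by rewrite ez trmx_mul symT.
(* With [e = w / |w|], [T_11 = a / v] and [c = (t - T_11) / mu], the mean of the other diagonal
   entries, [S] is [v^2 mu] times [T - (e (x) Te + Te (x) e) + (T_11 + c) e (x) e - c I]: the first
   row and column of [T] are cleared and the remaining block is made trace-free. *)
pose S := (v ^+ 2 * mu) *: T - (v * mu) *: (w^T *m z + z^T *m w)
          + (a * mu + (t * v - a)) *: (w^T *m w) - ((t * v - a) * v)%:M.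
have symS : S^T = S.
  rewrite /S linearB linearD linearB !linearZ linearD /= tr_scalar_mx symT.
  by rewrite !trmx_mul !trmxK addrC [w^T *m z + _]addrC addrC.
have wz : (w *m z^T) 0 0 = a by rewrite -ezT mulmxA ea.
have zw : (z *m w^T) 0 0 = a by rewrite ez ea.
have zz : (z *m z^T) 0 0 = k by rewrite -ezT mulmxA ez ek.
have outer4 (p q r s : 'rV[R]_m) :
    \tr (p^T *m q *m (r^T *m s)) = (q *m r^T) 0 0 * (s *m p^T) 0 0.
  rewrite mulmxA -[p^T *m q *m r^T]mulmxA [X in _ *m X *m _]mx11_scalar.
  by rewrite mul_mx_scalar -scalemxAl mxtraceZ mxtrace_outer.
have trT (p q : 'rV[R]_m) : \tr (T *m (p^T *m q)) = (q *m T *m p^T) 0 0.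
  by rewrite mulmxA mxtrace_mulC trace_mx11 mulmxA.
have zTw : (z *m T *m w^T) 0 0 = k by rewrite ez ek.
have wTz : (w *m T *m z^T) 0 0 = k by rewrite -ez zz.
have wTw : (w *m T *m w^T) 0 0 = a by rewrite ea.
have := mxtrace_gram_ge0 S; rewrite symS /S mxtrace_sqr_comb.
rewrite !(mulmxDl, mulmxDr) !mxtraceD !outer4 !trT !mxtrace_outer.
rewrite zTw wTz wTw wz zw zz -ev -et em.
rewrite [X in 0 <= X -> _](_ : _ = v ^+ 2 * mu * (v ^+ 2 * mu * \tr (T *m T)
    - (mu * (2 * k * v - a ^+ 2) + (t * v - a) ^+ 2))); last by ring.
by rewrite pmulr_rge0 ?subr_ge0 // mulr_gt0 // exprn_gt0.
Qed.

(** * Bounds on [kappa1] and the pointwise algebraic inequality *)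

Lemma kappa1_le1 (R : realType) (m : nat) (p : R) :
  (2 <= m)%N -> 1 < p -> kappa1 m p <= 1.
Proof.
move=> m2 p1; have m2R : 2 <= m%:R :> R by rewrite (ler_nat R 2 m).
rewrite /kappa1; case: ifPn => p2.
  by rewrite invf_le1; lra.
rewrite ler_pdivrMr; last by lra.
move: p2; rewrite -ltNge mul1r => p2; nra.
Qed.

(** The quantity [t v - a] is [v] times the sum of the diagonal entries other than [T_11], and the
    equation makes it [- (1 + (p - 2) th) a] with [0 <= th <= 1]. The factor [1 + (p - 2) th] is at
    least [1] if [p >= 2] and at least [p - 1] if [p < 2]. *)
Lemma kappa1_trace_bound (R : realType) (m : nat) (p eps v a t : R) :
  (2 <= m)%N -> 1 < p -> 0 < eps -> 0 < v -> (v + eps) * t = - (p - 2) * a ->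
  kappa1 m p * (m%:R - 1) * a ^+ 2 <= (t * v - a) ^+ 2.
Proof.
move=> m2 p1 e0 v0 et; have m2R : 2 <= m%:R :> R by rewrite (ler_nat R 2 m).
pose th := v / (v + eps).
have ve0 : v + eps != 0 by rewrite gt_eqF // addr_gt0.
have m1 : m%:R - 1 != 0 :> R by rewrite gt_eqF //; lra.
have th0 : 0 <= th by rewrite divr_ge0; lra.
have th1 : th <= 1 by rewrite ler_pdivrMr; lra.
have -> : t * v - a = - (1 + (p - 2) * th) * a.
  have -> : t = - (p - 2) * a / (v + eps) by rewrite -et mulrAC mulfV ?mul1r.
  by rewrite /th; field.
rewrite exprMn ler_wpM2r ?sqr_ge0 // sqrrN /kappa1.
case: ifPn => [p2|].
  by rewrite mulVf // exprn_ege1 // lerDl mulr_ge0 // subr_ge0.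
rewrite -ltNge => p2; rewrite mulfVK //.
have le_p : p - 1 <= 1 + (p - 2) * th by nra.
by rewrite ler_sqr // nnegrE; lra.
Qed.

(** Here [H] stands for the inverse metric, [w] for [du] and [T] for the Hessian. Writing
    [H = L^T L] turns every contraction into a Euclidean one for [w L^T] and [L T L^T], to which the
    trace inequality applies. *)
Lemma refined_kato_algebra (R : realType) (m : nat) (p eps : R) (H T : 'M[R]_m)
    (w : 'rV[R]_m) :
  (2 <= m)%N -> 1 < p -> 0 < eps -> H^T = H -> posdef H -> T^T = T ->
  ((w *m H *m w^T) 0 0 + eps) * \tr (H *m T)
    = - (p - 2) * (w *m H *m T *m H *m w^T) 0 0 ->
  (1 + kappa1 m p) * (w *m H *m T *m H *m T *m H *m w^T) 0 0
    <= (w *m H *m w^T) 0 0 * \tr (H *m T *m H *m T).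
Proof.
move=> m2 p1 e0 symH posH symT eq0.
have m2R : 2 <= m%:R :> R by rewrite (ler_nat R 2 m).
have [->|w0] := eqVneq w 0; first by rewrite !mul0mx mxE mulr0 mul0r.
have [L eH] := posdef_gram symH posH.
have := posH _ w0; set v := (w *m H *m w^T) 0 0 in eq0 * => v0.
set a := (w *m H *m T *m H *m w^T) 0 0 in eq0.
set k := (w *m H *m T *m H *m T *m H *m w^T) 0 0.
set t := \tr (H *m T) in eq0.
pose w' := w *m L^T; pose T' := L *m T *m L^T.
have w'T : w'^T = L *m w^T by rewrite trmx_mul trmxK.
have T'T : T'^T = T' by rewrite !trmx_mul trmxK symT mulmxA.
have ev : v = (w' *m w'^T) 0 0 by rewrite w'T /v eH /w' !mulmxA.
have ea : a = (w' *m T' *m w'^T) 0 0 by rewrite w'T /a eH /w' /T' !mulmxA.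
have ek : k = (w' *m T' *m T' *m w'^T) 0 0.
  by rewrite w'T /k eH /w' /T' !mulmxA.
have et : t = \tr T'.
  by rewrite /t eH /T' mxtrace_mulC mulmxA mxtrace_mulC mulmxA.
have eN : \tr (H *m T *m H *m T) = \tr (T' *m T').
  by rewrite eH /T' !mulmxA [RHS]mxtrace_mulC !mulmxA.
have cauchy : a ^+ 2 <= v * k.
  have [z ez] : exists z, z = w' *m T' by exists (w' *m T').
  have ezT : T' *m w'^T = z^T by rewrite ez [RHS]trmx_mul T'T.
  have wz : (w' *m z^T) 0 0 = a by rewrite -ezT mulmxA ea.
  have zw : (z *m w'^T) 0 0 = a by rewrite ez ea.
  have zz : (z *m z^T) 0 0 = k by rewrite -ezT mulmxA ez ek.
  (* Cauchy-Schwarz for [w'] and [z = w' T']: the squared norm of [v z - a w'] equals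
     [v (v k - a^2)]. *)
  have := mxtrace_gram_ge0 (v *: z - a *: w').
  have -> : (v *: z - a *: w')^T = v *: z^T - a *: w'^T.
    by apply/matrixP => i j; rewrite !mxE.
  rewrite trace_mx11 !(mulmxBl, mulmxBr).
  rewrite -!(scalemxAl, scalemxAr).
  have e3 (A B C D : 'M[R]_1) (x y : R) : (x *: (x *: A) - x *: (y *: B)
     - (y *: (x *: C) - y *: (y *: D))) 0 0
     = x * x * A 0 0 - x * y * B 0 0 - (y * x * C 0 0 - y * y * D 0 0).
    by rewrite !mxE; ring.
  rewrite e3 wz zw zz -ev.
  rewrite [X in 0 <= X -> _](_ : _ = v * (v * k - a ^+ 2)); last by ring.
  by rewrite pmulr_rge0 // subr_ge0.
have mu0 : 0 < m%:R - 1 :> R by lra.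
have := refined_trace_inequality T'T mu0 _ v0 ev ea ek et.
rewrite -eN => /(_ ltac:(ring)) main.
have := kappa1_trace_bound m2 p1 e0 v0 eq0.
have := kappa1_le1 m2 p1.
move: (kappa1 m p) (\tr _) (m%:R - 1) main mu0 => K X mu main mu0 K1 Kt.
have vmu : 0 < v * mu by rewrite mulr_gt0.
rewrite -(ler_pM2l vmu).
have -> : v * mu * (v * X) = v ^+ 2 * mu * X by ring.
apply: le_trans main.
apply: le_trans (_ : mu * (2 * k * v - a ^+ 2) + K * mu * a ^+ 2 <= _).
  rewrite -subr_ge0.
  (* The gap factors, so that exactly [kappa1 <= 1] and Cauchy-Schwarz make it nonnegative. *)
  have -> : mu * (2 * k * v - a ^+ 2) + K * mu * a ^+ 2
     - v * mu * ((1 + K) * k) = mu * (1 - K) * (v * k - a ^+ 2) by ring.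
  by rewrite !mulr_ge0 ?subr_ge0 // ltW.
by rewrite lerD2l.
Qed.

(** * Directional derivatives *)

Section DirectionalDerivatives.
Context {R : realType} {V : normedModType R}.
Implicit Types (x v : V) (f g : V -> R).

(** Restriction to a line: it gives access to one-variable tools, namely the mean value theorem and
    the chain rule, for functions that only have directional derivatives. *)
Lemma is_derive_lineP f (c v : V) (s d : R) :
  is_derive s 1 (fun t : R => f (t *: v + c)) d <->
  is_derive (s *: v + c) v f d.
Proof.
have e : (fun h : R => h^-1 *: (f (h *: v + (s *: v + c))
      - f (s *: v + c))) =
    (fun h : R => h^-1 *: (f ((h *: 1 + s) *: v + c) - f (s *: v + c))).
  by apply/funext => h; rewrite addrA -scalerDl [h *: 1]mulr1.
have edf : derivable (fun t : R => f (t *: v + c)) s 1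
    = derivable f (s *: v + c) v by rewrite /derivable e.
have eD : 'D_1 (fun t : R => f (t *: v + c)) s = 'D_v f (s *: v + c).
  by rewrite /derive e.
split=> -[hf hd]; split; first [by rewrite -edf | by rewrite -eD
  | by rewrite edf | by rewrite eD].
Qed.

Lemma is_derive_line f (c v : V) (s : R) :
  derivable f (s *: v + c) v ->
  is_derive s 1 (fun t : R => f (t *: v + c)) ('D_v f (s *: v + c)).
Proof. by move=> df; apply/is_derive_lineP; exact: derivableP. Qed.

Lemma is_derive_mul f g x v (df dg : R) :
  is_derive x v f df -> is_derive x v g dg ->
  is_derive x v (fun z => f z * g z) (df * g x + f x * dg).
Proof.
move=> hf hg; apply: (is_derive_eq (is_deriveM hf hg)).
by rewrite /GRing.scale /= addrC [g x * df]mulrC.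
Qed.

Lemma is_derive_bigsum (I : Type) (r : seq I) (P : pred I) (F : I -> V -> R)
    x v (dF : I -> R) :
  (forall i, is_derive x v (F i) (dF i)) ->
  is_derive x v (fun z => \sum_(i <- r | P i) F i z) (\sum_(i <- r | P i) dF i).
Proof.
move=> hF; elim: r => [|i r IHr].
  rewrite big_nil; under eq_fun do rewrite big_nil.
  exact: is_derive_cst.
rewrite big_cons; under eq_fun do rewrite big_cons.
by case: (P i); [exact: is_deriveD | exact: IHr].
Qed.

Lemma derivable_bigprod (I : Type) (r : seq I) (P : pred I) (F : I -> V -> R)
    x v :
  (forall i, derivable (F i) x v) ->
  derivable (fun z => \prod_(i <- r | P i) F i z) x v.
Proof.
move=> hF; elim: r => [|i r IHr].
  under eq_fun do rewrite big_nil.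
  exact: derivable_cst.
under eq_fun do rewrite big_cons.
by case: (P i); [exact: derivableM | exact: IHr].
Qed.

Lemma derivable_det n (A : V -> 'M[R]_n) x v :
  (forall i j, derivable (fun z => A z i j) x v) ->
  derivable (fun z => \det (A z)) x v.
Proof.
move=> dA; pose F (s : 'S_n) z := (-1) ^+ s * \prod_i A z i (s i).
have dF s : derivable (F s) x v.
  apply: derivableM; first exact: derivable_cst.
  by apply: derivable_bigprod => i; exact: dA.
by have [] := is_derive_bigsum (index_enum _) predT
  (fun s => derivableP (dF s)).
Qed.

(** By Cramer's rule the entries are cofactors divided by the determinant. The formula is used only
    where [A z] is invertible, hence the passage through a neighbourhood of [x]. *)
Lemma derivable_invmx n (A : V -> 'M[R]_n) x v (i j : 'I_n) :
  (\forall z \near x, A z \in unitmx) ->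
  (forall k l, derivable (fun z => A z k l) x v) ->
  derivable (fun z => invmx (A z) i j) x v.
Proof.
move=> uA dA.
have: {near x, (fun z => (\det (A z))^-1 * cofactor (A z) j i)
               =1 (fun z => invmx (A z) i j)}.
  by apply: filterS uA => z uz; rewrite /invmx uz !mxE.
move/near_eq_derivable; apply; apply: derivableM.
  apply: derivableV; last exact: derivable_det.
  by rewrite -unitfE -unitmxE; exact: nbhs_singleton uA.
rewrite /cofactor; apply: derivableM; first exact: derivable_cst.
apply: derivable_det => k l.
by under eq_fun do rewrite !mxE; exact: dA.
Qed.

(** Derivability being known, differentiating [A A^-1 = 1], which holds near [x], gives
    [dA A^-1 + A dB = 0], to be solved for [dB]. *)
Lemma is_derive_invmx n (A : V -> 'M[R]_n) x v (dA : 'M[R]_n) (i j : 'I_n) :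
  (\forall z \near x, A z \in unitmx) ->
  (forall k l, is_derive x v (fun z => A z k l) (dA k l)) ->
  is_derive x v (fun z => invmx (A z) i j)
    (- (invmx (A x) *m dA *m invmx (A x)) i j).
Proof.
move=> uA hA; have uAx : A x \in unitmx by exact: nbhs_singleton uA.
have dH k l : derivable (fun z => invmx (A z) k l) x v.
  by apply: derivable_invmx => // a b; have [] := hA a b.
pose dB := \matrix_(k, l) 'D_v (fun z => invmx (A z) k l) x.
have eq0 : dA *m invmx (A x) + A x *m dB = 0.
  apply/matrixP => k l; rewrite !mxE -big_split /=.
  have e1 : is_derive x v (fun z => \sum_a A z k a * invmx (A z) a l)
     (\sum_a (dA k a * invmx (A x) a l + A x k a * dB a l)).
    apply: is_derive_bigsum => a; apply: is_derive_mul => //.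
    by rewrite mxE; exact: derivableP.
  have e2 : is_derive x v (fun z => \sum_a A z k a * invmx (A z) a l) 0.
    apply: (near_eq_is_derive _ (is_derive_cst (1%:M k l : R) x v)).
    apply: filterS uA => z uz.
    by rewrite -(mulmxV uz) mxE.
  by rewrite -(@derive_val _ _ _ _ _ _ _ e1) (@derive_val _ _ _ _ _ _ _ e2).
have eB : dB = - (invmx (A x) *m dA *m invmx (A x)).
  rewrite -[LHS](mulKmx uAx) -mulmxA -mulmxN; congr (_ *m _).
  by apply/eqP; rewrite -addr_eq0 addrC eq0.
have <- : dB i j = - (invmx (A x) *m dA *m invmx (A x)) i j.
  by rewrite eB mxE.
by rewrite mxE; exact: derivableP.
Qed.

(** The chain rule is applied on the line through [x] in the direction [v], where derivability is
    the same as differentiability. *)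
Lemma is_derive_powR_comp f x v (df q : R) :
  0 < f x -> is_derive x v f df ->
  is_derive x v (fun z => f z `^ q) (q * f x `^ (q - 1) * df).
Proof.
move=> fx0 hf; have ex : (0 : R) *: v + x = x by rewrite scale0r add0r.
rewrite -ex in hf; move/is_derive_lineP : hf => hf.
rewrite -{1}ex; apply/is_derive_lineP.
have h0 : 0 < f ((0 : R) *: v + x) by rewrite ex.
have hq := is_derive1_powR q h0.
have [dl el] := hf; have [dq eq] := hq.
have dc :
    derivable ((fun t : R => t `^ q) \o (fun t : R => f (t *: v + x))) 0 1.
  by apply/derivable1_diffP/differentiable_comp; apply/derivable1_diffP.
split; first exact: dc.
have := derive1_comp dl dq.
by rewrite !derive1E el eq ex.
Qed.

End DirectionalDerivatives.

(** * Symmetry of second derivatives *)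

(** The mean value theorem is used twice: along [v] for the difference [phi] of two parallel sides,
    then along [w] for the derivative ['D_v f]. *)
Lemma second_difference_mean_value (R : realType) (V : normedModType R)
    (f : V -> R) (y v w : V) (h : R) (A : set V) :
  0 < h ->
  (forall s t : R, 0 <= s <= h -> 0 <= t <= h -> A (y + s *: v + t *: w)) ->
  (forall z, A z -> derivable f z v) ->
  (forall z, A z -> derivable ('D_v f) z w) ->
  exists s t : R, [/\ 0 <= s <= h, 0 <= t <= h &
    f (y + h *: v + h *: w) - f (y + h *: v) - f (y + h *: w) + f y
    = h ^+ 2 * 'D_w ('D_v f) (y + s *: v + t *: w)].
Proof.
move=> h0 inA dfv dfvw; have h00 : 0 <= h <= h by rewrite lexx ltW.
have z00 : (0 : R) <= 0 <= h by rewrite lexx ltW.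
have MVT0 (F dF : R -> R) : (forall r, 0 <= r <= h -> is_derive r 1 F (dF r)) ->
    exists2 c, c \in `]0, h[ & F h - F 0 = dF c * (h - 0).
  move=> dFP; apply: MVT => // [r|].
    by rewrite in_itv /= => /andP[/ltW r0 /ltW rh]; apply: dFP; rewrite r0.
  apply: derivable_within_continuous => r; rewrite in_itv /= => hr.
  by have [] := dFP r hr.
pose phi (s : R) := f (s *: v + (y + h *: w)) - f (s *: v + y).
pose dphi (s : R) := 'D_v f (s *: v + (y + h *: w)) - 'D_v f (s *: v + y).
have Ev s t : s *: v + (y + t *: w) = y + s *: v + t *: w.
  by rewrite addrA [s *: v + y]addrC.
have Ev0 s : s *: v + y = y + s *: v + 0 *: w by rewrite scale0r addr0 addrC.
have dphiP s : 0 <= s <= h -> is_derive s 1 phi (dphi s).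
  move=> sh; apply: is_deriveB; apply: is_derive_line; apply: dfv.
    by rewrite Ev; exact: inA.
  by rewrite Ev0; exact: inA.
have [s] := MVT0 phi dphi dphiP.
rewrite in_itv /= => /andP[/ltW s0 /ltW sh] es.
have sh0 : 0 <= s <= h by rewrite s0.
pose psi (t : R) := 'D_v f (t *: w + (y + s *: v)).
pose dpsi (t : R) := 'D_w ('D_v f) (t *: w + (y + s *: v)).
have dpsiP t : 0 <= t <= h -> is_derive t 1 psi (dpsi t).
  move=> th; apply: is_derive_line; apply: dfvw.
  by rewrite addrC; exact: inA.
have [t] := MVT0 psi dpsi dpsiP.
rewrite in_itv /= => /andP[/ltW t0 /ltW th] et.
exists s, t; split; rewrite ?s0 ?t0 //.
have := es; rewrite {1 2}/phi.
have -> : dphi s = dpsi t * h.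
  rewrite -[h in RHS]subr0 -et /psi /dphi scale0r add0r.
  by rewrite [s *: v + y]addrC Ev [h *: w + _]addrC.
rewrite !scale0r !add0r subr0 /dpsi => e.
rewrite [y + s *: v + _]addrC expr2 mulrAC -mulrA [h * _]mulrC -e.
rewrite Ev [h *: v + y]addrC; ring.
Qed.

(** The second difference is symmetric in [v] and [w], so the two mixed derivatives agree when taken
    at suitable points of one small parallelogram. Continuity at [y] brings both within [e / 2] of
    their values there. *)
Lemma derive_comm (R : realType) (V : normedModType R) (f : V -> R)
    (y v w : V) :
  (\forall z \near y, derivable f z v /\ derivable f z w) ->
  (\forall z \near y, derivable ('D_v f) z w /\ derivable ('D_w f) z v) ->
  {for y, continuous ('D_w ('D_v f))} -> {for y, continuous ('D_v ('D_w f))} ->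
  'D_w ('D_v f) y = 'D_v ('D_w f) y.
Proof.
move=> df ddf cvw cwv; apply/eqP; rewrite -subr_eq0 -normr_le0.
apply/ler_addgt0Pr => e e0; rewrite add0r.
have e20 : 0 < e / 2 by rewrite divr_gt0.
have near_lt (F : V -> R) : {for y, continuous F} ->
    \forall z \near y, `|F y - F z| < e / 2.
  by move=> /cvgrPdist_lt; exact.
have [d /= d0 dP] := (nbhs_ballP _ _).1
  (filterI (filterI df ddf) (filterI (near_lt _ cvw) (near_lt _ cwv))).
(* Small enough for the parallelogram of sides [h v] and [h w] to stay in the ball of radius [d];
   the summand [1] keeps the denominator positive when [v = w = 0]. *)
pose h := d / 2 / (`|v| + `|w| + 1).
have n0 : 0 < `|v| + `|w| + 1 by rewrite ltr_wpDl // addr_ge0.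
have h0 : 0 < h by rewrite !divr_gt0.
have hd : h * (`|v| + `|w|) < d.
  rewrite /h mulrAC ltr_pdivrMr // -mulrA ltr_pM2l //.
  have := normr_ge0 v; have := normr_ge0 w; lra.
have inA s t : 0 <= s <= h -> 0 <= t <= h -> ball y d (y + s *: v + t *: w).
  move=> /andP[s0 sh] /andP[t0 th]; rewrite -ball_normE /=.
  rewrite -addrA opprD addNKr normrN (le_lt_trans (ler_normD _ _)) //.
  rewrite !normrZ !ger0_norm // (le_lt_trans _ hd) // mulrDr lerD //.
    by rewrite ler_wpM2r.
  by rewrite ler_wpM2r.
have inA' s t : 0 <= s <= h -> 0 <= t <= h -> ball y d (y + s *: w + t *: v).
  by move=> hs ht; rewrite addrAC; exact: inA.
have [s1 [t1 [s1h t1h e1]]] := second_difference_mean_value h0 inA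
  (fun z Az => (dP z Az).1.1.1)
  (fun z Az => (dP z Az).1.2.1).
have [s2 [t2 [s2h t2h e2]]] := second_difference_mean_value h0 inA'
  (fun z Az => (dP z Az).1.1.2)
  (fun z Az => (dP z Az).1.2.2).
have [_ [b1 _]] := dP _ (inA _ _ s1h t1h).
have [_ [_ b2]] := dP _ (inA' _ _ s2h t2h).
have e12 : 'D_w ('D_v f) (y + s1 *: v + t1 *: w)
         = 'D_v ('D_w f) (y + s2 *: w + t2 *: v).
  rewrite [y + h *: w + _]addrAC in e2.
  have cancel (a1 a2 a3 a4 P Q : R) : a1 - a2 - a3 + a4 = h ^+ 2 * P ->
      a1 - a3 - a2 + a4 = h ^+ 2 * Q -> P = Q.
    move=> eP eQ; apply: (mulfI (_ : h ^+ 2 != 0)).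
      by rewrite expf_neq0 // gt_eqF.
    by rewrite -eP -eQ; ring.
  exact: cancel e1 e2.
rewrite -e12 in b2; move: b1 b2; clear.
move: ('D_w ('D_v f) y) ('D_v ('D_w f) y) (derive _ (_ + _) w) => P Q S PS QS.
rewrite [e]splitr (le_trans (ler_distD S _ _)) //.
by rewrite lerD // ltW // distrC.
Qed.

Lemma partialC (R : realType) (m : nat) (U : set 'rV[R]_m)
    (f : 'rV[R]_m -> R) (y : 'rV[R]_m) (a b : 'I_m) :
  open U -> Cn_on 2 U f -> U y ->
  partial a (partial b f) y = partial b (partial a f) y.
Proof.
move=> oU [_ f1] Uy.
have nU : \forall z \near y, U z by exact: open_nbhs_nbhs.
have fC k l z : U z -> {for z, continuous (partial l (partial k f))}.
  by move=> Uz; have [_ [_ /(_ l) [_ [c _]]]] := f1 k; exact: c.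
have fd k z : U z -> derivable f z (delta_mx 0 k).
  by move=> Uz; have [c _] := f1 k; exact: c.
have fdd k l z : U z -> derivable (partial k f) z (delta_mx 0 l).
  by move=> Uz; have [_ [_ /(_ l) [c _]]] := f1 k; exact: c.
apply: derive_comm; [| | exact: fC | exact: fC]; apply: filterS nU => z Uz.
  by split; exact: fd.
by split; exact: fdd.
Qed.

(** * Riemannian identities in a chart *)

Lemma bilinear_formE (R : comNzRingType) (n : nat) (A : 'M[R]_n)
    (x y : 'rV[R]_n) :
  (x *m A *m y^T) 0 0 = \sum_a \sum_b A a b * x 0 a * y 0 b.
Proof.
rewrite -mulmxA mxE; apply: eq_bigr => a _; rewrite mxE mulr_sumr.
by apply: eq_bigr => b _; rewrite mxE; ring.
Qed.

Lemma tensor_sqnormE (R : realType) (m : nat) (G T : 'M[R]_m) :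
  (invmx G)^T = invmx G -> T^T = T ->
  tensor_sqnorm G T = \tr (invmx G *m T *m invmx G *m T).
Proof.
move=> symH symT; rewrite /tensor_sqnorm -!mulmxA [T *m _]mulmxA /mxtrace.
have symE (A : 'M[R]_m) : A^T = A -> forall a b, A a b = A b a.
  by move=> symA a b; rewrite -{1}symA mxE.
move: (symE _ symH) (symE _ symT); set H := invmx G => HC TC.
apply: eq_bigr => a _; rewrite exchange_big mxE; apply: eq_bigr => c _.
rewrite mxE mulr_sumr; apply: eq_bigr => b _; rewrite mxE mulr_suml mulr_sumr.
by apply: eq_bigr => d _; rewrite [H b d]HC [T a b]TC; ring.
Qed.

(* Christoffel symbols of the first kind, [dG c] being the derivative of the
   metric in the direction [c]. *)
Definition christoffel1 (R : fieldType) (m : nat) (dG : 'I_m -> 'M[R]_m)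
    (l a b : 'I_m) : R := 2^-1 * (dG a b l + dG b a l - dG l a b).

(** * Connection identities at a point, with the derivatives as free data *)

Section MetricDerivative.
Context {R : realType} {m : nat}.
Variables (H : 'M[R]_m) (dG : 'I_m -> 'M[R]_m) (w : 'rV[R]_m) (D : 'M[R]_m).
Hypotheses (symH : H^T = H) (symdG : forall c, (dG c)^T = dG c).

Let X := w *m H.
Let T : 'M[R]_m := \matrix_(a, b)
  (D a b - \sum_c (\sum_l H c l * christoffel1 dG l a b) * w 0 c).

Let TE a b : T a b = D a b - \sum_l X 0 l * christoffel1 dG l a b.
Proof.
rewrite mxE; congr (_ - _); under eq_bigr do rewrite mulr_suml.
rewrite exchange_big; apply: eq_bigr => l _; rewrite mxE mulr_suml.
by apply: eq_bigr => c _; ring.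
Qed.

Let dGC c a b : dG c a b = dG c b a.
Proof. by rewrite -{1}symdG mxE. Qed.

Let HC a b : H a b = H b a.
Proof. by rewrite -{1}symH mxE. Qed.

(** The connection is torsion-free: [christoffel1] is symmetric in its last two indices. *)
Lemma hessian_sym : D^T = D -> T^T = T.
Proof.
move=> symD; apply/matrixP => a b; rewrite mxE !TE; congr (_ - _).
  by rewrite -{1}symD mxE.
apply: eq_bigr => l _; rewrite /christoffel1 [dG l b a]dGC; ring.
Qed.

(** The left side is the product rule for the [c]-derivative of [g^ab w_a w_b], with [- H dG H] as
    derivative of the inverse metric. Against the symmetric [X^a X^l] two of the three Christoffel
    terms cancel, and the third one matches that derivative. *)
Lemma dsqnorm_hessian c :
  \sum_a \sum_b ((- (H *m dG c *m H) a b * w 0 a + H a b * D c a) * w 0 b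
                 + H a b * w 0 a * D c b) = 2 * \sum_a T c a * X 0 a.
Proof.
have quad : \sum_a \sum_b (H *m dG c *m H) a b * w 0 a * w 0 b
    = \sum_a \sum_b dG c a b * X 0 a * X 0 b.
  by rewrite -!bilinear_formE /X trmx_mul symH !mulmxA.
have lin : \sum_a \sum_b H a b * D c a * w 0 b = \sum_a D c a * X 0 a.
  apply: eq_bigr => a _; rewrite mxE mulr_sumr.
  by apply: eq_bigr => b _; rewrite [H a b]HC; ring.
have skew : \sum_a \sum_l X 0 l * X 0 a * dG a c l
    = \sum_a \sum_l X 0 l * X 0 a * dG l c a.
  by rewrite exchange_big; do 2 apply: eq_bigr => ? _; ring.
have -> : \sum_a \sum_b
      ((- (H *m dG c *m H) a b * w 0 a + H a b * D c a) * w 0 b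
       + H a b * w 0 a * D c b)
    = - (\sum_a \sum_b (H *m dG c *m H) a b * w 0 a * w 0 b)
      + \sum_a \sum_b H a b * D c a * w 0 b
      + \sum_a \sum_b H b a * D c b * w 0 a.
  rewrite -sumrN -!big_split; apply: eq_bigr => a _ /=.
  rewrite -sumrN -!big_split; apply: eq_bigr => b _ /=.
  by rewrite [H b a]HC; ring.
rewrite quad [X in _ + X]exchange_big /= lin.
have -> : \sum_a T c a * X 0 a = \sum_a D c a * X 0 a
    - 2^-1 * (\sum_a \sum_l X 0 l * X 0 a * dG c a l
       + \sum_a \sum_l X 0 l * X 0 a * dG a c l
       - \sum_a \sum_l X 0 l * X 0 a * dG l c a).
  rewrite -sumrN -!big_split mulr_sumr -sumrN -big_split /=.
  apply: eq_bigr => a _; rewrite TE mulrBl; congr (_ - _).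
  rewrite -sumrN -!big_split mulr_suml mulr_sumr /=; apply: eq_bigr => l _.
  by rewrite /christoffel1; ring.
rewrite skew addrK.
have -> : \sum_a \sum_b dG c a b * X 0 a * X 0 b
    = \sum_a \sum_l X 0 l * X 0 a * dG c a l.
  by do 2 apply: eq_bigr => ? _; ring.
by field.
Qed.

(** The left side is the coordinate divergence of the gradient. Its equality with the trace of the
    Hessian says that raising an index commutes with covariant differentiation. *)
Lemma trace_hessian :
  \sum_a (\sum_b (- (H *m dG a *m H) a b * w 0 b + H a b * D a b)
    + \sum_c (\sum_l H a l * christoffel1 dG l a c) * X 0 c) = \tr (H *m T).
Proof.
rewrite /mxtrace; apply: eq_trans
  (_ : \sum_a \sum_b
         H a b * (D a b - \sum_l X 0 l * christoffel1 dG l a b) = _).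
  have XE b : \sum_e H b e * w 0 e = X 0 b.
    by rewrite mxE; apply: eq_bigr => e _; rewrite HC mulrC.
  apply: eq_bigr => a _.
  have -> : \sum_b (- (H *m dG a *m H) a b * w 0 b + H a b * D a b)
     = \sum_b (H a b * D a b - \sum_c H a b * dG a b c * X 0 c).
    rewrite big_split /= addrC [RHS]big_split /=; congr (_ + _).
    under eq_bigr do rewrite mulNr.
    rewrite !sumrN; congr (- _).
    under eq_bigr do rewrite -mulmxA mxE mulr_suml.
    rewrite exchange_big; apply: eq_bigr => b _ /=.
    have -> : \sum_c H a b * dG a b c * X 0 c = H a b * \sum_c dG a b c * X 0 c.
      by rewrite mulr_sumr; apply: eq_bigr => c _; rewrite mulrA.
    under eq_bigr do rewrite -mulrA.
    rewrite -mulr_sumr; congr (_ * _).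
    under eq_bigr do rewrite mxE mulr_suml.
    rewrite exchange_big; apply: eq_bigr => c _ /=.
    by rewrite -XE mulr_sumr; apply: eq_bigr => e _; rewrite mulrA.
  have -> : \sum_c (\sum_l H a l * christoffel1 dG l a c) * X 0 c
      = \sum_l \sum_c H a l * christoffel1 dG l a c * X 0 c.
    by under eq_bigr do rewrite mulr_suml; rewrite exchange_big.
  rewrite -big_split; apply: eq_bigr => b _ /=.
  rewrite -addrA mulrBr; congr (_ + _); rewrite mulr_sumr -!sumrN -big_split /=.
  (* Metric compatibility for symbols of the first kind: [christoffel1 dG b a c + christoffel1 dG c
     a b = dG a b c]. *)
  apply: eq_bigr => c _; rewrite /christoffel1 [dG c a b]dGC [dG a c b]dGC.
  by field.
under [RHS]eq_bigr do rewrite mxE.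
rewrite [RHS]exchange_big; apply: eq_bigr => a _; apply: eq_bigr => b _ /=.
by rewrite HC TE.
Qed.

End MetricDerivative.

(** * Derivatives of [|du|^2] and of the weighted gradient in a chart *)

Lemma partial_val (R : realType) (m : nat) (h : 'rV[R]_m -> R) (y : 'rV[R]_m)
    (c : 'I_m) (d : R) :
  is_derive y (delta_mx 0 c) h d -> partial c h y = d.
Proof. by move=> hd; rewrite /partial derive_val. Qed.

Section Chart.
Context {R : realType} {m : nat}.
Variables (U : set 'rV[R]_m) (g : 'rV[R]_m -> 'M[R]_m) (f : 'rV[R]_m -> R).
Hypotheses (openU : open U) (smooth_f : smooth_on U f).
Hypothesis smooth_g : forall a b, smooth_on U (fun y => g y a b).
Hypothesis sym_g : forall y, U y -> (g y)^T = g y.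
Hypothesis posdef_g : forall y, U y -> posdef (g y).

Variable y : 'rV[R]_m.
Hypothesis Uy : U y.

Let dG c : 'M[R]_m := \matrix_(a, b) partial c (fun z => g z a b) y.
Let D : 'M[R]_m := \matrix_(a, b) partial a (partial b f) y.
Let H := invmx (g y).
Let w := differential f y.
Let T := hessian g f y.

Let nearU : \forall z \near y, U z.
Proof. exact: open_nbhs_nbhs. Qed.

Let dg c a b : is_derive y (delta_mx 0 c) (fun z => g z a b) (dG c a b).
Proof.
rewrite mxE; apply: derivableP.
by have [_ /(_ c) [d _]] := smooth_g a b 1%N; exact: d.
Qed.

Let ddf c a : is_derive y (delta_mx 0 c) (partial a f) (D c a).
Proof.
rewrite mxE; apply: derivableP.
by have [_ /(_ a) [_ [_ /(_ c) [d _]]]] := smooth_f 2%N; exact: d.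
Qed.

Let dinvg c a b : is_derive y (delta_mx 0 c) (fun z => invmx (g z) a b)
  (- (H *m dG c *m H) a b).
Proof.
apply: is_derive_invmx; last exact: dg.
by apply: filterS nearU => z /posdef_g; exact: posdef_unitmx.
Qed.

Let symH : H^T = H.
Proof. by rewrite /H trmx_inv sym_g. Qed.

Let symdG c : (dG c)^T = dG c.
Proof.
apply/matrixP => a b; rewrite !mxE; apply: near_eq_derive.
by apply: filterS nearU => z Uz; rewrite -{1}(sym_g Uz) mxE.
Qed.

Let symD : D^T = D.
Proof.
by apply/matrixP => a b; rewrite !mxE; exact: partialC (smooth_f 2%N) Uy.
Qed.

Let wE a : w 0 a = partial a f y.
Proof. by rewrite mxE. Qed.

Lemma christoffelE k a b :
  christoffel g k a b y = \sum_l H k l * christoffel1 dG l a b.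
Proof.
rewrite /christoffel mulr_sumr; apply: eq_bigr => l _.
by rewrite /christoffel1 !mxE; ring.
Qed.

Lemma hessianE :
  T = \matrix_(a, b)
    (D a b - \sum_c (\sum_l H c l * christoffel1 dG l a b) * w 0 c).
Proof.
apply/matrixP => a b; rewrite !mxE; congr (_ - _).
  by congr (partial _ _ _); apply/funext => z; rewrite mxE.
by apply: eq_bigr => c _; rewrite christoffelE.
Qed.

Lemma trmx_hessian : T^T = T.
Proof. by rewrite hessianE; exact: hessian_sym symdG symD. Qed.

Lemma is_derive_sqnorm c :
  is_derive y (delta_mx 0 c)
    (fun z => covec_sqnorm (g z) (differential f z))
    (2 * \sum_a T c a * (w *m H) 0 a).
Proof.
rewrite hessianE -(@dsqnorm_hessian _ _ H dG w D symH).
rewrite /covec_sqnorm; apply: is_derive_bigsum => a.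
apply: is_derive_bigsum => b; rewrite !wE.
under eq_fun do rewrite !mxE.
exact: is_derive_mul (is_derive_mul (dinvg c a b) (ddf c a)) (ddf c b).
Qed.

Lemma is_derive_gradient c a :
  is_derive y (delta_mx 0 c) (fun z => gradient g f z 0 a)
    (\sum_b (- (H *m dG c *m H) a b * w 0 b + H a b * D c b)).
Proof.
under eq_fun do rewrite mxE.
apply: is_derive_bigsum => b; rewrite wE.
under eq_fun do rewrite mxE.
exact: is_derive_mul (dinvg c a b) (ddf c b).
Qed.

Lemma gradientE z h : U z -> gradient g h z = differential h z *m invmx (g z).
Proof.
move=> Uz; apply/rowP => a; rewrite !mxE; apply: eq_bigr => b _.
by rewrite mulrC -{1}(sym_g Uz) -trmx_inv [_^T a b]mxE.
Qed.

Lemma vec_sqnorm_gradient z h : U z ->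
  vec_sqnorm (g z) (gradient g h z) = covec_sqnorm (g z) (differential h z).
Proof.
move=> Uz; have uz := posdef_unitmx (posdef_g Uz).
rewrite /vec_sqnorm /covec_sqnorm -!bilinear_formE gradientE //.
by rewrite trmx_mul trmx_inv (sym_g Uz) mulmxKV // mulmxA.
Qed.

(** With [P = |du|^2 + eps] and [X = grad u], the product rule gives [div (P^q X) = P^q div X + q
    P^(q-1) dP(X)], where [div X] is the trace of the Hessian and [dP = 2 T(X, .)]. Since [P > 0],
    the power [P^(q-1)] factors out. *)
Lemma divergence_weighted_gradient (q eps : R) : 0 < eps ->
  let N := covec_sqnorm (g y) (differential f y) in
  divergence g (fun z => (vec_sqnorm (g z) (gradient g f z) + eps) `^ q
                          *: gradient g f z) y
  = (N + eps) `^ (q - 1) *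
    ((N + eps) * \tr (H *m T) + 2 * q * (w *m H *m T *m H *m w^T) 0 0).
Proof.
move=> eps0 N; pose P z := vec_sqnorm (g z) (gradient g f z) + eps.
have PN : P y = N + eps by rewrite /P vec_sqnorm_gradient.
have N0 : 0 <= N.
  rewrite /N /covec_sqnorm -bilinear_formE.
  have [->|w0] := eqVneq (differential f y) 0; first by rewrite !mul0mx mxE.
  by rewrite ltW // posdef_invmx //; [exact: sym_g | exact: posdef_g].
have P0 : 0 < P y by rewrite PN ltr_wpDl.
pose X := w *m H.
have XE : gradient g f y = X by rewrite gradientE.
(* The norms of the gradient and of the differential are identified on [U] only, so the derivative
   is transferred through a neighbourhood of [y]. *)
have dP c : is_derive y (delta_mx 0 c) P (2 * \sum_a T c a * X 0 a).
  apply: (is_derive_eq (near_eq_is_derive _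
    (is_deriveD (is_derive_sqnorm c) (is_derive_cst eps y (delta_mx 0 c))))).
    by apply: filterS nearU => z Uz; rewrite /P vec_sqnorm_gradient.
  by rewrite addr0.
have dF a : partial a (fun z => (P z `^ q *: gradient g f z) 0 a) y
    = q * P y `^ (q - 1) * (2 * \sum_b T a b * X 0 b) * X 0 a
      + P y `^ q *
        \sum_b (- (H *m dG a *m H) a b * w 0 b + H a b * D a b).
  have -> : (fun z => (P z `^ q *: gradient g f z) 0 a)
      = (fun z => P z `^ q * gradient g f z 0 a).
    by apply/funext => z; rewrite mxE.
  by rewrite (partial_val (is_derive_mul (is_derive_powR_comp q P0 (dP a))
    (is_derive_gradient a a))) XE.
have Pq : P y `^ q = P y `^ (q - 1) * P y.
  rewrite -{3}(powRr1 (ltW P0)) -powRD ?subrK //.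
  by apply/implyP => _; rewrite gt_eqF.
rewrite [LHS]/divergence [LHS]/mxtrace; under eq_bigr do rewrite mxE dF.
have -> : \tr (H *m T) =
    \sum_a (\sum_b (- (H *m dG a *m H) a b * w 0 b + H a b * D a b)
    + \sum_c (\sum_l H a l * christoffel1 dG l a c) * X 0 c).
  by rewrite (@trace_hessian _ _ H dG w D symH symdG) hessianE.
have -> : (w *m H *m T *m H *m w^T) 0 0 = \sum_a \sum_b T a b * X 0 a * X 0 b.
  by rewrite -bilinear_formE /X trmx_mul symH !mulmxA.
rewrite -PN mulrDr mulrA -Pq !mulr_sumr -big_split /=; apply: eq_bigr => a _.
rewrite mulrDr [RHS]addrAC -addrA addrC [RHS]addrC -/P.
have -> : \sum_c christoffel g a a c y * (P y `^ q *: gradient g f y) 0 c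
   = P y `^ q * \sum_c (\sum_l H a l * christoffel1 dG l a c) * X 0 c.
  rewrite mulr_sumr; apply: eq_bigr => c _.
  by rewrite christoffelE XE mxE mulrCA.
have -> : \sum_b T a b * X 0 a * X 0 b = (\sum_b T a b * X 0 b) * X 0 a.
  by rewrite mulr_suml; apply: eq_bigr => b _; ring.
by ring.
Qed.

Lemma differential_sqnorm :
  differential (fun z => covec_sqnorm (g z) (differential f z)) y
  = 2 *: (w *m H *m T).
Proof.
apply/rowP => c; rewrite [LHS]mxE (partial_val (is_derive_sqnorm c)).
rewrite !mxE; congr (2 * _); apply: eq_bigr => a _.
by rewrite -{1}trmx_hessian mxE mulrC.
Qed.

End Chart.

(** * The inequality in a chart, then on the manifold *)

(** Cancelling the positive power of [|du|^2 + eps] in the vanishing divergence, with [2 q = p - 2],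
    leaves the trace identity that the algebraic inequality assumes. The denominator [4] absorbs the
    square of the factor in [d|du|^2 = 2 T(grad u, .)]. *)
Lemma refined_kato_chart (R : realType) (m : nat) (U : set 'rV[R]_m)
    (g : 'rV[R]_m -> 'M[R]_m) (f : 'rV[R]_m -> R) (y : 'rV[R]_m) (p eps : R) :
  (2 <= m)%N -> 1 < p -> 0 < eps -> open U -> U y -> smooth_on U f ->
  (forall a b, smooth_on U (fun z => g z a b)) ->
  (forall z, U z -> (g z)^T = g z) -> (forall z, U z -> posdef (g z)) ->
  divergence g (fun z => (vec_sqnorm (g z) (gradient g f z) + eps)
                          `^ ((p - 2) / 2) *: gradient g f z) y = 0 ->
  (1 + kappa1 m p) / 4 * vec_sqnorm (g y)
      (gradient g (fun z => covec_sqnorm (g z) (differential f z)) y)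
    <= covec_sqnorm (g y) (differential f y)
       * tensor_sqnorm (g y) (hessian g f y).
Proof.
move=> m2 p1 e0 oU Uy sf sg symg posg div0.
pose H := invmx (g y); pose w := differential f y; pose T := hessian g f y.
have HT : H^T = H by rewrite /H trmx_inv symg.
have posH : posdef H := posdef_invmx (symg _ Uy) (posg _ Uy).
have TT : T^T = T := trmx_hessian oU sf symg Uy.
set N := covec_sqnorm (g y) (differential f y).
have NE : N = (w *m H *m w^T) 0 0 by rewrite bilinear_formE.
have N0 : 0 <= N.
  rewrite NE; have [->|w0] := eqVneq w 0; first by rewrite !mul0mx mxE.
  by rewrite ltW // posH.
have eqtr : ((w *m H *m w^T) 0 0 + eps) * \tr (H *m T)
    = - (p - 2) * (w *m H *m T *m H *m w^T) 0 0.
  move: div0; rewrite (divergence_weighted_gradient oU sf sg symg posg Uy) //.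
  rewrite -/N -NE -/H -/w -/T => /eqP; rewrite mulf_eq0 => /orP[|/eqP e].
    by rewrite gt_eqF // powR_gt0 // ltr_wpDl.
  by apply/eqP; rewrite -subr_eq0 -[X in _ == X]e; apply/eqP; field.
rewrite (vec_sqnorm_gradient symg posg _ Uy).
rewrite (differential_sqnorm oU sf sg symg posg Uy) -/H -/w -/T.
rewrite tensor_sqnormE // NE /covec_sqnorm -bilinear_formE.
have -> : (2 *: (w *m H *m T) *m invmx (g y) *m (2 *: (w *m H *m T))^T) 0 0
    = 4 * (w *m H *m T *m H *m T *m H *m w^T) 0 0.
  rewrite linearZ /= -!scalemxAl -scalemxAr scalerA mxE -natrM.
  by rewrite !trmx_mul TT HT !mulmxA.
rewrite mulrA mulfVK ?pnatr_eq0 //.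
exact: refined_kato_algebra m2 p1 e0 HT posH TT eqtr.
Qed.

Lemma Cn_on_sub (R : realType) (m n : nat) (U W : set 'rV[R]_m)
    (f : 'rV[R]_m -> R) :
  U `<=` W -> Cn_on n W f -> Cn_on n U f.
Proof.
move=> UW; elim: n f => [|n IHn] f [cf df]; split=> //.
- by move=> y /UW; exact: cf.
- by move=> y /UW; exact: cf.
- by move=> k; have [dk ck] := df k; split=> [y /UW|]; [exact: dk | exact: IHn].
Qed.

(** Near each of its points, this image contains the part of the open chart image that the
    continuous inverse chart sends into [A]. *)
Lemma chart_img_open_sub (R : realType) (m : nat) (M : smooth_manifold R m)
    (i : chart M) (A : set M) :
  open A -> open (chart_map i @` (chart_dom i `&` A)).
Proof.
move=> oA; rewrite openE => _ [x [ix Ax] <-].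
have Ix : (chart_map i @` chart_dom i) (chart_map i x) by exists x.
have nI := open_nbhs_nbhs (conj (@chart_img_open _ _ M i) Ix).
have nA : nbhs (chart_inv i (chart_map i x)) A.
  by rewrite chart_mapK //; exact: open_nbhs_nbhs.
apply: filterS (filterI nI (chart_inv_continuous Ix nA)) => _ [[z iz <-]] /=.
by rewrite /preimage /= chart_mapK // => Az; exists z.
Qed.

Theorem lemma3p3 (R : realType) (m : nat) (M : smooth_manifold R m)
    (g : riemannian_metric M) (Omega : set M) (eps p : R) (u : M -> R)
    (hm : (2 <= m)%N) (hOmega : domain Omega) (heps : 0 < eps) (hp : 1 < p)
    (hu : p_eps_solution g p eps Omega u) :
  forall x : M, Omega x -> forall i : chart M, chart_dom i x ->
    sqnorm_du g u i x * sqnorm_hess g u i x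
      >= (1 + kappa1 m p) / 4 * sqnorm_grad_sqnorm_du g u i x.
Proof.
move=> x Ox i ix; have [smooth_u eq_u] := hu; have [oO _ _] := hOmega.
have sub : chart_map i @` (chart_dom i `&` Omega)
    `<=` chart_map i @` chart_dom i.
  by move=> _ [z [iz _] <-]; exists z.
(* The open set [U] is the chart image of [chart_dom i] intersected with [Omega]; the metric's
   properties restrict to it, and [p_eps_field] unfolds to the weighted gradient. *)
apply: (refined_kato_chart hm hp heps (chart_img_open_sub oO) _ (smooth_u i)).
- by exists x.
- by move=> a b n; exact: Cn_on_sub sub (metric_smooth g i a b n).
- by move=> z /sub Iz; exact: (@Defs.metric_sym _ _ _ g i z Iz).
- move=> z /sub Iz v v0; rewrite bilinear_formE.
  exact: (@metric_pos _ _ _ g i z Iz v v0).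
- exact: eq_u.
Qed.
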